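(* Let $\mathbb{F}=\mathbb{F}_2$, $n\ge1$, $m\ge1$ and $V=\mathbb{F}^n$. Then: (a) $\beta_{\rm sep}(\mathbb{F}[V^m]^{\mathcal{S}_n})=2^{\lfloor\log_2(n)\rfloor}$; (b) $\sigma(n)=\lfloor\log_2(n)\rfloor+1$.
   Context: The symmetric group $\mathcal{S}_n$ acts on $V=\mathbb{F}^n$ by permuting coordinates and diagonally on $V^m=V\oplus\cdots\oplus V$. The coordinate ring is $\mathbb{F}[V^m]=\mathbb{F}[x(j)_i\mid 1\le i\le n,\ 1\le j\le m]$, where $x(j)_i$ is the $i$-th coordinate of the $j$-th vector, and $\pi\cdot x(j)_i=x(j)_{\pi(i)}$ for $\pi\in\mathcal{S}_n$; $\mathbb{F}[V^m]^{\mathcal{S}_n}$ is the ring of invariant polynomials. Elements $\underline{u},\underline{v}\in V^m$ are separated by a set $S$ of invariants if $f(\underline{u})\ne f(\underline{v})$ for some $f\in S$. A subset $S\subset\mathbb{F}[V^m]^{\mathcal{S}_n}$ is separating if any $\underline{u},\underline{v}\in V^m$ that can be separated by $\mathbb{F}[V^m]^{\mathcal{S}_n}$ can also be separated by $S$. $\beta_{\rm sep}(\mathbb{F}[V^m]^{\mathcal{S}_n})$ is the minimal integer $\beta$ such that the set of all homogeneous invariants of degree $\le\beta$ is separating for $\mathbb{F}[V^m]^{\mathcal{S}_n}$. Expansion: for $1\le m_0\le m$, $f\in\mathbb{F}[V^{m_0}]^{\mathcal{S}_n}$ and indices $1\le j_1<\cdots<j_{m_0}\le m$, let $f^{(j_1,\ldots,j_{m_0})}\in\mathbb{F}[V^m]^{\mathcal{S}_n}$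 be obtained from $f$ by substituting $x(l)_i\mapsto x(j_l)_i$ for all $1\le l\le m_0$, $1\le i\le n$. The expansion of $S\subset\mathbb{F}[V^{m_0}]^{\mathcal{S}_n}$ is $S^{[m]}=\{f^{(j_1,\ldots,j_{m_0})}\mid f\in S,\ 1\le j_1<\cdots<j_{m_0}\le m\}\subset\mathbb{F}[V^m]^{\mathcal{S}_n}$. $\sigma(n)$ denotes the minimal number $m_0\geq 1$ such that the expansion $S^{[m]}$ of some separating set $S$ for $\mathbb{F}[V^{m_0}]^{\mathcal{S}_n}$ is a separating set for $\mathbb{F}[V^m]^{\mathcal{S}_n}$ for all $m\ge m_0$. *)

(* Defs.v *)
From mathcomp Require Import all_boot all_order all_fingroup all_algebra.
From mathcomp Require Import mpoly.

Set Implicit Arguments.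
Unset Strict Implicit.
Unset Printing Implicit Defensive.

Import GRing.Theory.
Local Open Scope ring_scope.

(* V = F^n, and V^m is encoded as 'M[F]_(m, n): the j-th vector is the j-th
   row.  The coordinate ring F[V^m] is {mpoly F[m * n]}, the pair (j, i) being
   numbered by mxvec_index, in accordance with mxvec on points. *)
Definition coordX (F : fieldType) (m n : nat) (j : 'I_m) (i : 'I_n) :
  {mpoly F[m * n]} := 'X_(mxvec_index j i).

Definition evalV (F : fieldType) (m n : nat)
  (f : {mpoly F[m * n]}) (u : 'M[F]_(m, n)) : F :=
  f.@[fun k => mxvec u 0 k].

(* substV f M is f with x(j)_i replaced by M j i. *)
Definition substV (F : fieldType) (m n k : nat)
  (f : {mpoly F[m * n]}) (M : 'M[{mpoly F[k]}]_(m, n)) : {mpoly F[k]} :=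
  f \mPo [tuple mxvec M 0 l | l < m * n].

Definition actS (F : fieldType) (m n : nat) (p : 'S_n)
  (f : {mpoly F[m * n]}) : {mpoly F[m * n]} :=
  substV f (\matrix_(j < m, i < n) coordX F j (p i)).

Definition Sn_invariant (F : fieldType) (m n : nat) (f : {mpoly F[m * n]}) :
  Prop := forall p : 'S_n, actS p f = f.

Definition separated_by (F : fieldType) (m n : nat)
  (S : {mpoly F[m * n]} -> Prop) (u v : 'M[F]_(m, n)) : Prop :=
  exists2 f, S f & evalV f u <> evalV f v.

Definition separating (F : fieldType) (m n : nat)
  (S : {mpoly F[m * n]} -> Prop) : Prop :=
  (forall f, S f -> Sn_invariant f) /\
  (forall u v : 'M[F]_(m, n),
     separated_by (@Sn_invariant F m n) u v -> separated_by S u v).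

Definition homog_invariant_le (F : fieldType) (m n b : nat)
  (f : {mpoly F[m * n]}) : Prop :=
  Sn_invariant f /\ exists2 d, (d <= b)%N & f \is d.-homog.

Definition is_least (P : nat -> Prop) (k : nat) : Prop :=
  P k /\ forall l, P l -> (k <= l)%N.

Definition is_beta_sep (F : fieldType) (m n b : nat) : Prop :=
  is_least (fun b' => separating (@homog_invariant_le F m n b')) b.

Definition expand (F : fieldType) (m0 m n : nat) (js : 'I_m0 -> 'I_m)
  (f : {mpoly F[m0 * n]}) : {mpoly F[m * n]} :=
  substV f (\matrix_(l < m0, i < n) coordX F (js l) i).

Definition expansion (F : fieldType) (m0 m n : nat)
  (S : {mpoly F[m0 * n]} -> Prop) (g : {mpoly F[m * n]}) : Prop :=
  exists f (js : 'I_m0 -> 'I_m),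
    [/\ S f, {homo js : a b / (a < b)%N} & g = expand js f].

Definition is_sigma (F : fieldType) (n s : nat) : Prop :=
  is_least
    (fun m0 => (1 <= m0)%N /\
       exists2 S : {mpoly F[m0 * n]} -> Prop, separating S &
         forall m, (m0 <= m)%N -> separating (@expansion F m0 m n S)) s.

(* Main.v *)
(* Two points of V^m are separated by invariants iff their columns, as multisets in F_2^m, differ.

   For a linear form l on F_2^m, the elementary symmetric function of degree 2^a in the values of l
   on the n columns evaluates to C(N, 2^a) mod 2, the a-th binary digit of the number N of columns
   on which l is 1.  As n < 2^(r+1), where r = floor(log_2 n), the degrees 2^a with a <= r determine
   N for every l, and Fourier inversion on F_2^m recovers the multiset.  Conversely, a function of
   degree < 2^r sums to 0 over a cube of dimension 2^r, so that an invariant of degree < 2^r takes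
   the same value at 0 and at a row with 2^r ones, C(2^r, k) being even for 0 < k < 2^r.

   If all projections to r+1 coordinates of two multisets agree, the difference of multiplicities is
   an integer function on F_2^m with vanishing marginals of order <= r+1; it is then 0 or of
   l^1-norm at least 2^(r+2) > 2n.  The even- and odd-weight vectors of F_2^(r+1), padded with zeros, show
   that r coordinates do not suffice. *)
Require Import Defs.
From mathcomp Require Import all_boot all_order all_fingroup all_algebra.
From mathcomp Require Import mpoly.
From mathcomp Require Import zify.

Set Implicit Arguments.
Unset Strict Implicit.
Unset Printing Implicit Defensive.

Import GRing.Theory Num.Theory.
Local Open Scope ring_scope.

(** * Binomial coefficients modulo 2 *)

(** Modulo 2, (1 + X)^(2N) = (1 + X^2)^N; Pascal's rule, applied twice, compares the
    coefficients. *)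
Lemma odd_bin_double N k :
  (odd 'C(N.*2, k.*2) = odd 'C(N, k)) * (odd 'C(N.*2, k.*2.+1) = false).
Proof.
elim: N k => [|N IHN] [|k]; try by rewrite ?doubleS ?double0 ?bin0.
  by rewrite double0 bin1 odd_double bin0.
rewrite !doubleS !binS !oddD -!doubleS !IHN.
by case: (odd _); case: (odd _).
Qed.

Lemma odd_bin_even N k : odd 'C(N, k.*2) = odd 'C(N./2, k).
Proof.
rewrite -{1}(odd_double_half N); case: (odd N);
  last by rewrite add0n odd_bin_double.
rewrite add1n; case: k => [|k]; first by rewrite !bin0.
by rewrite doubleS binS oddD !odd_bin_double addbF -doubleS odd_bin_double.
Qed.

Lemma odd_bin_exp2 r k : (0 < k < 2 ^ r)%N -> odd 'C(2 ^ r, k) = false.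
Proof.
elim: r k => [|r IHr] k; first by rewrite expn0; case: k => [|[]].
rewrite expnS mul2n -{1 2 3}(odd_double_half k); case: (odd k).
  by rewrite add1n odd_bin_double.
rewrite add0n double_gt0 ltn_double odd_bin_double; exact: IHr.
Qed.

(** Exponent 0 gives the last binary digit; halving both numbers shifts the exponents by one. *)
Lemma eq_bin_exp2 r N N' : (N < 2 ^ r)%N -> (N' < 2 ^ r)%N ->
  (forall a, (a < r)%N -> odd 'C(N, 2 ^ a) = odd 'C(N', 2 ^ a)) -> N = N'.
Proof.
elim: r N N' => [|r IHr] N N'; first by rewrite expn0 !ltnS !leqn0 => /eqP-> /eqP->.
rewrite expnS mul2n => ltN ltN' eqC.
rewrite -(odd_double_half N) -(odd_double_half N').
have /= := eqC 0 isT; rewrite expn0 !bin1 => ->.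
congr (_ + _.*2)%N; apply: IHr => [||a lt_a_r].
- by rewrite ltn_half_double.
- by rewrite ltn_half_double.
by rewrite -!odd_bin_even -mul2n -expnS eqC.
Qed.

(** * Multisets of columns *)

Definition colmult (R : eqType) m n (u : 'M[R]_(m, n)) (x : 'cV[R]_m) : nat :=
  \sum_(i < n) (col i u == x).

Lemma colmult_perm (R : eqType) m n (u v : 'M[R]_(m, n)) :
  colmult u =1 colmult v -> exists p : 'S_n, u = col_perm p v.
Proof.
pose cols (w : 'M[R]_(m, n)) := [tuple col i w | i < n].
have colsE w x : count_mem x (cols w) = colmult w x.
  rewrite count_map -sum1_count big_mkcond /= big_enum /=.
  by apply: eq_bigr => i _; case: eqP.
move=> eq_uv; have /tuple_permP[p Dp]: perm_eq (cols u) (cols v).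
  by apply/allP => x _; rewrite /= !colsE eq_uv.
exists p; apply/matrixP => j i; rewrite mxE.
have /(congr1 (fun t : n.-tuple 'cV[R]_m => tnth t i j 0)) :
  cols u = [tuple tnth (cols v) (p k) | k < n] by exact: val_inj.
by rewrite !tnth_mktuple !mxE.
Qed.

(** The default [0] of [nth] fills the columns beyond [s], hence the extra multiplicity at [0]. *)
Lemma colmult_seq (R : nmodType) m n (s : seq 'cV[R]_m) x : (size s <= n)%N ->
  colmult (\matrix_(j < m, i < n) (nth 0 s i) j 0) x =
  (count_mem x s + (n - size s) * (x == 0%R))%N.
Proof.
move=> le_s_n; rewrite /colmult.
rewrite (eq_bigr (fun i : 'I_n => nat_of_bool (nth 0 s i == x))); last first.
  move=> i _; congr (nat_of_bool (_ == _)).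
  by apply/matrixP => j k; rewrite !mxE ord1.
rewrite -(big_mkord xpredT (fun i => nat_of_bool (nth 0 s i == x))).
rewrite (@big_cat_nat _ _ _ (size s)) //=; congr (_ + _)%N.
  rewrite -sum1_count [RHS]big_mkcond [RHS](big_nth 0) /=.
  by apply: eq_bigr => i _; case: eqP.
rewrite big_nat_cond (eq_bigr (fun=> nat_of_bool (x == 0))); last first.
  by move=> i /andP[/andP[le_s_i _] _]; rewrite nth_default // eq_sym.
by rewrite -big_nat_cond sum_nat_const_nat.
Qed.

(** * Substitution and evaluation *)

Section Substitution.
Variables (F : fieldType) (n : nat).

Lemma eval_mxvec m (f : {mpoly F[m * n]}) (u : 'M[F]_(m, n)) (h : 'I_(m * n) -> F) :
  (forall j i, h (mxvec_index j i) = u j i) -> f.@[h] = evalV f u.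
Proof.
by move=> hE; apply: meval_eq => k; case/mxvec_indexP: k => j i; rewrite mxvecE.
Qed.

(** An arbitrary relabelling [g] of the variables covers both the permutation action and the
    expansion. *)
Lemma evalV_substV m m' (g : 'I_m -> 'I_n -> 'I_m' * 'I_n)
    (f : {mpoly F[m * n]}) (u : 'M[F]_(m', n)) :
  evalV (substV f (\matrix_(j, i) coordX F (g j i).1 (g j i).2)) u =
  evalV f (\matrix_(j, i) u (g j i).1 (g j i).2).
Proof.
rewrite /evalV /substV comp_mpoly_meval; apply: eval_mxvec => j i.
by rewrite tnth_mktuple mxvecE !mxE mevalXU mxvecE.
Qed.

Lemma evalV_actS m p (f : {mpoly F[m * n]}) u :
  evalV (actS p f) u = evalV f (col_perm p u).
Proof.
rewrite (evalV_substV (fun j i => (j, p i))).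
by congr evalV; apply/matrixP => j i; rewrite !mxE.
Qed.

Lemma evalV_expand m0 m (js : 'I_m0 -> 'I_m) (f : {mpoly F[m0 * n]}) u :
  evalV (expand js f) u = evalV f (rowsub js u).
Proof.
rewrite (evalV_substV (fun j i => (js j, i))).
by congr evalV; apply/matrixP => j i; rewrite !mxE.
Qed.

Lemma evalV_colmult m (f : {mpoly F[m * n]}) (u v : 'M[F]_(m, n)) :
  Sn_invariant f -> colmult u =1 colmult v -> evalV f u = evalV f v.
Proof.
by move=> inv_f /colmult_perm[p ->]; rewrite -evalV_actS inv_f.
Qed.

Lemma substV_substV m m' k (f : {mpoly F[m * n]})
    (M : 'M[{mpoly F[m' * n]}]_(m, n)) (M' : 'M[{mpoly F[k]}]_(m', n)) :
  substV (substV f M) M' = substV f (map_mx (fun g => substV g M') M).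
Proof.
rewrite /substV (comp_mpolyE f [tuple mxvec M 0 l | l < _]) (comp_mpolyE f).
rewrite raddf_sum /=.
apply: eq_bigr => a _; rewrite linearZ /= rmorph_prod /=; congr (_ *: _).
apply: eq_bigr => l _; rewrite rmorphXn /= !tnth_mktuple.
by case/mxvec_indexP: l => j i; rewrite !mxvecE mxE.
Qed.

Lemma substV_coordX m k j i (M : 'M[{mpoly F[k]}]_(m, n)) :
  substV (coordX F j i) M = M j i.
Proof.
by rewrite /substV comp_mpolyXU -tnth_nth tnth_mktuple mxvecE.
Qed.

(** Invariance is an equality of polynomials, which values over a finite field do not detect; hence
    the composition of substitutions. In either order x(l)_i becomes x(js l)_(p i). *)
Lemma expand_invariant m0 m (js : 'I_m0 -> 'I_m) (f : {mpoly F[m0 * n]}) :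
  Sn_invariant f -> Sn_invariant (expand js f).
Proof.
move=> inv_f p; rewrite -{2}(inv_f p) /expand /actS !substV_substV.
by congr substV; apply/matrixP => j i; rewrite !mxE !substV_coordX !mxE.
Qed.

End Substitution.

(** * Elementary symmetric polynomials in the values of a linear form *)

Section ElementaryLinear.
Variables (F : fieldType) (m n : nat).
Implicit Types (l : 'rV[F]_m) (k : nat).

Definition elemlin l k : {mpoly F[m * n]} :=
  \sum_(A : {set 'I_n} | #|A| == k) \prod_(i in A) \sum_j l 0 j *: coordX F j i.

Lemma elemlin_homog l k : elemlin l k \is k.-homog.
Proof.
rewrite rpred_sum // => A /eqP <-; rewrite -sum1_card.
elim/big_rec2: _ => [|i d p _ hom_p]; first exact: dhomog1.
apply: dhomogM => //; rewrite rpred_sum // => j _.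
by rewrite dhomogZ // dhomogX /= mdeg1.
Qed.

Lemma elemlin_invariant l k : Sn_invariant (elemlin l k).
Proof.
move=> p; rewrite /actS /substV /elemlin raddf_sum /=.
rewrite [RHS](reindex_inj (imset_inj (@perm_inj _ p))) /=.
apply: eq_big => A; first by rewrite card_imset //; apply: perm_inj.
move=> _; rewrite rmorph_prod big_imset /=; last by move=> i j _ _; apply: perm_inj.
apply: eq_bigr => i _; rewrite raddf_sum; apply: eq_bigr => j _ /=.
by rewrite linearZ /= [_ \mPo _]substV_coordX mxE.
Qed.

Lemma evalV_elemlin l k (u : 'M[F]_(m, n)) :
  evalV (elemlin l k) u =
  \sum_(A : {set 'I_n} | #|A| == k) \prod_(i in A) (l *m u) 0 i.
Proof.
rewrite /evalV /elemlin raddf_sum /=; apply: eq_bigr => A _.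
rewrite rmorph_prod; apply: eq_bigr => i _; rewrite raddf_sum mxE.
by apply: eq_bigr => j _; rewrite /= mevalZ mevalXU mxvecE.
Qed.

End ElementaryLinear.

(** * Fourier inversion on F_2^m *)

Lemma F2_eq0_or1 (a : 'F_2) : {a = 0} + {a = 1}.
Proof. by case: a => [[|[|[]]]] //= lt2; [left | right]; apply: val_inj. Qed.

Lemma F2_nat_eq (a b : nat) : (a%:R == b%:R :> 'F_2) = (odd a == odd b).
Proof.
have E c : c%:R = (odd c)%:R :> 'F_2.
  rewrite -[in LHS](odd_double_half c) natrD -muln2 natrM.
  by rewrite [2%:R](_ : _ = 0) ?mulr0 ?addr0 //; apply: val_inj.
by rewrite E [b%:R]E; case: (odd a); case: (odd b).
Qed.

(** Over F_2 the product over [A] is 1 if [A] lies in the support of [l *m u], and 0 otherwise. *)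
Lemma evalV_elemlin_F2 m n (l : 'rV['F_2]_m) k (u : 'M['F_2]_(m, n)) :
  evalV (elemlin n l k) u = 'C(#|[set i | (l *m u) 0 i != 0]|, k)%:R.
Proof.
set B := [set i | _]; rewrite evalV_elemlin -cards_draws -sum1_card natr_sum.
rewrite (bigID (fun A : {set 'I_n} => A \subset B)) /= [X in _ + X]big1 ?addr0.
  apply: eq_big => [A|A /andP[_ /subsetP sAB]]; first by rewrite !inE andbC.
  rewrite big1 // => i /sAB; rewrite inE.
  by case: (F2_eq0_or1 ((l *m u) 0 i)) => ->; rewrite ?eqxx.
move=> A /andP[_ /subsetPn[i iA]]; rewrite inE negbK => /eqP l0.
by rewrite (bigD1 i) //= l0 mul0r.
Qed.

(** The nontrivial character of F_2, integer-valued so that multiplicities are recovered exactly and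
    not only modulo 2. *)
Definition chi2 (a : 'F_2) : int := (-1) ^+ (a != 0).

Lemma chi2D : {morph chi2 : a b / a + b >-> a * b}.
Proof.
move=> a b; case: (F2_eq0_or1 a) => ->; first by rewrite add0r mul1r.
by case: (F2_eq0_or1 b) => ->.
Qed.

(** Orthogonality of characters: if [x j 0] is nonzero, translating [l] by the [j]-th basis vector
    flips every sign, so the sum is its own opposite. *)
Lemma sum_chi2 m (x : 'cV['F_2]_m) :
  \sum_(l : 'rV['F_2]_m) chi2 ((l *m x) 0 0) =
  (#|{: 'rV['F_2]_m}| * (x == 0%R))%N%:R.
Proof.
have [->|/cV0Pn[j xj]] := eqVneq x 0.
  rewrite muln1 (eq_bigr (fun=> 1)) => [|l _]; last by rewrite mulmx0 mxE.
  by rewrite sumr_const.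
rewrite muln0; set S := LHS; suff: S = - S by lia.
rewrite {1}/S (reindex_inj (addrI (delta_mx 0 j))) /= -sumrN.
apply: eq_bigr => l _; rewrite mulmxDl mxE chi2D -rowE mxE.
by case: (F2_eq0_or1 (x j 0)) xj => ->; rewrite ?eqxx // mulN1r.
Qed.

(** The transform of [colmult u] at [l] is the number of columns where [l] is 0 minus the number
    where it is 1. Multiplying by the number of forms avoids a division. *)
Lemma colmult_fourier m n (u : 'M['F_2]_(m, n)) x :
  (#|{: 'rV['F_2]_m}| * colmult u x)%N%:R =
  \sum_(l : 'rV['F_2]_m) chi2 ((l *m x) 0 0) *
      (n%:R - (#|[set i | (l *m u) 0 i != 0]|)%:R *+ 2).
Proof.
transitivity (\sum_(i < n) \sum_(l : 'rV['F_2]_m) chi2 ((l *m (col i u - x)) 0 0)).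
  rewrite /colmult big_distrr natr_sum; apply: eq_bigr => i _.
  by rewrite sum_chi2 subr_eq0.
rewrite exchange_big; apply: eq_bigr => l _ /=.
rewrite (eq_bigr (fun i => chi2 ((l *m x) 0 0) * chi2 ((l *m u) 0 i))).
  rewrite -big_distrr; congr (_ * _); rewrite /= cardsE -sum1_card natr_sum.
  rewrite [in RHS]big_mkcond -sumrMnl.
  transitivity (\sum_(i < n) (1 - ((l *m u) 0 i != 0)%:R *+ 2) : int).
    by apply: eq_bigr => i _; rewrite /chi2; case: eqP.
  by rewrite sumrB sumr_const card_ord; congr (_ - _);
    apply: eq_bigr => i _; rewrite -topredE /=; case: eqP.
move=> i _; rewrite -chi2D; congr chi2.
rewrite mulmxBr mxE [(- _ : 'M_1) _ _]mxE colE mulmxA -colE mxE addrC.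
by have ->: - (l *m x) 0 0 = (l *m x) 0 0; first
  by case: (F2_eq0_or1 ((l *m x) 0 0)) => ->; apply: val_inj.
Qed.

Lemma homog_invariants_separate m n r (u v : 'M['F_2]_(m, n)) :
  (n < 2 ^ r.+1)%N ->
  colmult u =1 colmult v \/
  separated_by (@homog_invariant_le 'F_2 m n (2 ^ r)) u v.
Proof.
move=> lt_n; pose N (w : 'M['F_2]_(m, n)) (l : 'rV_m) := #|[set i | (l *m w) 0 i != 0]|.
have ltN w l : (N w l < 2 ^ r.+1)%N.
  by rewrite (leq_ltn_trans (max_card _)) ?card_ord.
case: (boolP [exists l, [exists a : 'I_r.+1,
  odd 'C(N u l, 2 ^ a) != odd 'C(N v l, 2 ^ a)]]) => [|eqN].
  case/existsP=> l /existsP[a neq]; right.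
  exists (elemlin n l (2 ^ a)).
    split; first exact: elemlin_invariant.
    by exists (2 ^ a)%N; [rewrite leq_exp2l // -ltnS | exact: elemlin_homog].
  by rewrite !evalV_elemlin_F2; apply/eqP; rewrite F2_nat_eq.
(* The Fourier formula yields the multiplicity times the number of linear forms, a factor to be
   cancelled. *)
left=> x; have K0 : #|{: 'rV['F_2]_m}| != 0%N.
  by rewrite -lt0n; apply/card_gt0P; exists 0.
apply/eqP; rewrite -(eqn_pmul2l (m := #|{: 'rV['F_2]_m}|)) ?lt0n //.
rewrite -(eqr_nat int) !colmult_fourier; apply/eqP/eq_bigr => l _.
suff eqNl : N u l = N v l by congr (_ * (_ - _%:R *+ 2)).
apply: (eq_bin_exp2 (ltN u l) (ltN v l)) => a lt_a.
move: eqN; rewrite negb_exists => /forallP/(_ l).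
by rewrite negb_exists => /forallP/(_ (Ordinal lt_a)); rewrite negbK => /eqP.
Qed.

(** * Invariants of degree below 2^r *)

Lemma F2_mulrn (x : 'F_2) k : x *+ k = x *+ odd k.
Proof.
rewrite -[in LHS](odd_double_half k) mulrnDr -muln2 mulnC mulrnA.
rewrite [x *+ 2](_ : _ = 0) ?mul0rn ?addr0 //.
by case: (F2_eq0_or1 x) => ->; apply: val_inj.
Qed.

(* A monomial of degree less than [#|T|] misses the coordinate [g i] of some [i] in [T], so
   toggling [i] pairs off the subsets of [T]. *)
Lemma sum_subsets_meval N (I : finType) (g : I -> 'I_N)
    (h : {set I} -> 'I_N -> 'F_2) (T : {set I}) (f : {mpoly 'F_2[N]}) :
  injective g ->
  (forall A i k, g i != k -> h (i |: A) k = h A k) ->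
  {in msupp f, forall a, (mdeg a < #|T|)%N} ->
  \sum_(A : {set I} | A \subset T) f.@[h A] = 0.
Proof.
move=> inj_g hE deg_f; under eq_bigr => A _ do rewrite mevalE.
rewrite exchange_big big_seq big1 //= => a /deg_f lt_a.
have /exists_inP[i iT /eqP ai] : [exists i in T, a (g i) == 0%N].
  (* Otherwise the exponents at the distinct variables [g i], for [i] in [T], already add up to
     [#|T|]. *)
  apply: contraLR lt_a => /exists_inPn a_pos; rewrite -leqNgt.
  rewrite mdegE (bigID (fun k => k \in g @: T)) /= big_imset /=; last by move=> ? ? _ _ /inj_g.
  rewrite (leq_trans _ (leq_addr _ _)) // -sum1_card leq_sum // => i /a_pos.
  by rewrite lt0n.
pose G A := f@_a * \prod_k h A k ^+ a k.
rewrite -/(G _) (bigID (fun A : {set I} => i \in A)) /=.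
(* The subsets containing [i] are reindexed by those avoiding it; the two halves then agree and
   cancel in characteristic 2. *)
rewrite (reindex_onto (fun A => i |: A) (fun A => A :\ i)) /=; last first.
  by move=> A /andP[_ iA]; rewrite setD1K.
rewrite (eq_big (fun A : {set I} => (A \subset T) && (i \notin A)) G).
- by rewrite -mulr2n F2_mulrn.
- move=> A; rewrite subUset sub1set iT setU11 andbT /=.
  congr (_ && _); apply/eqP/idP => [<-|]; first by rewrite setD11.
  exact: setU1K.
move=> A _; congr (_ * _); apply: eq_bigr => k _.
have [<-|ne_gk] := eqVneq (g i) k; first by rewrite ai !expr0.
by rewrite hE.
Qed.

Section IndicatorRow.
Variables (m n : nat) (j0 : 'I_m).

Definition indicator_row (A : {set 'I_n}) : 'M['F_2]_(m, n) :=
  \matrix_(j, i) ((j == j0) && (i \in A))%:R.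

(** Only the size of [A] matters, so an invariant restricted to these points is a function of
    [#|A|]. *)
Lemma colmult_indicator_row A x :
  colmult (indicator_row A) x =
  (#|A| * (delta_mx j0 0%R == x) + (n - #|A|) * (0%R == x))%N.
Proof.
have -> : (n - #|A|)%N = #|~: A| by rewrite [RHS]cardsCs setCK card_ord.
rewrite /colmult (bigID (fun i => i \in A)) /= -!sum_nat_const.
congr (_ + _)%N; last first.
  apply: eq_big => [i|i /negbTE iA]; first by rewrite inE.
  by congr (nat_of_bool (_ == _)); apply/matrixP => j k; rewrite !mxE iA andbF.
apply: eq_bigr => i iA; congr (nat_of_bool (_ == _)).
by apply/matrixP => j k; rewrite !mxE iA ord1 eqxx andbT.
Qed.

(* The sum of [f] over the subsets of a set of size [2 ^ r] vanishes by the degree bound; grouped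
   by cardinality, the binomial weights [C(2 ^ r, k)] are even for [0 < k < 2 ^ r]. *)
Lemma evalV_indicator_row r (f : {mpoly 'F_2[m * n]}) (T : {set 'I_n}) :
  #|T| = (2 ^ r)%N -> Sn_invariant f ->
  {in msupp f, forall a, (mdeg a < 2 ^ r)%N} ->
  evalV f (indicator_row T) = evalV f (indicator_row set0).
Proof.
move=> cT inv_f deg_f.
(* The default 0 concerns sizes above [n], which no subset of [T] has. *)
pose g k := if [pick A : {set 'I_n} | #|A| == k] is Some A
  then evalV f (indicator_row A) else 0.
have gE A : evalV f (indicator_row A) = g #|A|.
  rewrite /g; case: pickP => [B /eqP cB | /(_ A)]; last by rewrite eqxx.
  by apply: evalV_colmult => // x; rewrite !colmult_indicator_row cB.
have: \sum_(A : {set 'I_n} | A \subset T) evalV f (indicator_row A) = 0.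
  apply: (sum_subsets_meval (g := mxvec_index j0) (h := fun A k => mxvec (indicator_row A) 0 k)).
  - by move=> i i' /cast_ord_inj/enum_rank_inj[].
  - move=> A i k; case/mxvec_indexP: k => j i' ne; rewrite !mxvecE !mxE !inE.
    have [ej|//] := eqVneq j j0; have [ei|//] := eqVneq i' i.
    by rewrite ej ei eqxx in ne.
  by move=> a /deg_f; rewrite cT.
rewrite (partition_big (fun A : {set 'I_n} => inord #|A| : 'I_(2 ^ r).+1) xpredT) //=.
rewrite (eq_bigr (fun k : 'I_(2 ^ r).+1 => g k *+ 'C(2 ^ r, k))); last first.
  move=> k _; have -> : 'C(2 ^ r, k) = #|[set A : {set 'I_n} | A \subset T & #|A| == k]|.
    by rewrite cards_draws cT.
  rewrite -sumr_const; apply: eq_big => A.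
    rewrite inE; have [sAT /=|//] := boolP (A \subset T).
    have ltA : (#|A| < (2 ^ r).+1)%N by rewrite ltnS -cT subset_leq_card.
    by apply/eqP/eqP => [<-|eqAk]; [rewrite inordK | apply: val_inj; rewrite /= inordK].
  case/andP=> sAT /eqP <-; rewrite gE inordK // ltnS -cT subset_leq_card //.
have ne_max : ord_max != ord0 :> 'I_(2 ^ r).+1.
  by apply/eqP => /(congr1 val)/eqP; rewrite /= expn_eq0.
rewrite (bigD1 ord0) //= (bigD1 ord_max) //= big1 => [|k /andP[k0 kmax]]; last first.
  rewrite F2_mulrn odd_bin_exp2 // lt0n ltn_neqAle -ltnS ltn_ord andbT.
  by apply/andP.
rewrite bin0 binn addr0 !mulr1n !gE cT cards0.
by case: (F2_eq0_or1 (g 0%N)) => ->; case: (F2_eq0_or1 (g (2 ^ r)%N)) => ->.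
Qed.

End IndicatorRow.

(** * Integer functions with vanishing marginals *)

(* Fibering over the first coordinate: either both fibers carry mass, and each has vanishing
   marginals of order [< t - 1], or one is empty and the other inherits the order [t]. *)
Lemma marginals_norm (T : finType) (J : eqType) (x : J -> pred T) (d : T -> int)
    (l : seq J) (P : pred T) t :
  {in P &, forall y z, {in l, forall j, x j y = x j z} -> y = z} ->
  (forall S, subseq S l -> (size S < t)%N ->
     \sum_(y | P y && all (x^~ y) S) d y = 0) ->
  (exists2 y, P y & d y != 0) ->
  (2 ^ t <= \sum_(y | P y) `|d y|)%N.
Proof.
elim: l P t => [|j l IHl] P [|t] sepP margP [y0 Py0 dy0].
- by rewrite (bigD1 y0) //= ltn_addr // absz_gt0.
(* With no coordinate left, [P] holds at [y0] only, and the marginal for the empty list is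
   [d y0]. *)
- have /= := margP [::] isT isT; rewrite (big_pred1 y0) => [d0|y /=].
    by rewrite d0 in dy0.
  by rewrite andbT; apply/idP/eqP => [Py|->//]; apply: sepP.
- by rewrite (bigD1 y0) //= ltn_addr // absz_gt0.
pose fib b y := P y && (x j y == b).
have margE S : \sum_(y | P y && all (x^~ y) S) d y =
    \sum_(y | fib true y && all (x^~ y) S) d y +
    \sum_(y | fib false y && all (x^~ y) S) d y.
  rewrite (bigID (x j)); congr (_ + _); apply: eq_bigl => y.
    by rewrite /fib eqb_id andbAC.
  by rewrite /fib eqbF_neg andbAC.
have normE : (\sum_(y | P y) `|d y| =
    \sum_(y | fib true y) `|d y| + \sum_(y | fib false y) `|d y|)%N.
  rewrite (bigID (x j)); congr (_ + _)%N; apply: eq_bigl => y.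
    by rewrite /fib eqb_id.
  by rewrite /fib eqbF_neg.
have sep_fib b : {in fib b &, forall y z, {in l, forall i, x i y = x i z} -> y = z}.
  move=> y z /andP[Py /eqP xy] /andP[Pz /eqP xz] eq_l.
  apply: sepP => // i; rewrite inE => /predU1P[->|/eq_l //].
  by rewrite xy xz.
have subl S : subseq S l -> subseq S (j :: l).
  by move=> sSl; apply: subseq_trans sSl (subseq_cons _ _).
have marg_fib b S : subseq S l -> (size S < t)%N ->
    \sum_(y | fib b y && all (x^~ y) S) d y = 0.
  (* The marginal on the fiber over [true] is the one for [j :: S], which costs one order; the other
     fiber follows by subtraction. *)
  move=> sSl ltS; have marg1 : \sum_(y | fib true y && all (x^~ y) S) d y = 0.
    rewrite -[RHS](margP (j :: S)) //= ?eqxx //.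
        by apply: eq_bigl => y; rewrite /fib eqb_id andbA.
  case: b => //; have := margE S; rewrite marg1 add0r => <-.
  by rewrite margP ?subl // ltnW.
have [b [y fib_y dy]] : exists b, exists2 y, fib b y & d y != 0.
  by exists (x j y0), y0; rewrite // /fib Py0 /=.
have normE' : (\sum_(y | P y) `|d y| =
    \sum_(y | fib b y) `|d y| + \sum_(y | fib (~~ b) y) `|d y|)%N.
  by rewrite normE; case: (b); rewrite // addnC.
have [/exists_inP d_nb|/exists_inPn d_nb] := boolP [exists y in fib (~~ b), d y != 0].
  rewrite normE' expnS mul2n -addnn leq_add //.
    by apply: IHl; [exact: sep_fib | exact: marg_fib | exists y].
  by apply: IHl; [exact: sep_fib | exact: marg_fib | exact: d_nb].
rewrite normE' (leq_trans _ (leq_addr _ _)) //.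
(* As [d] vanishes on the opposite fiber, the marginals over [fib b] are those over [P] and no order
   is lost. *)
apply: IHl; [exact: sep_fib | move=> S sSl ltS | by exists y].
rewrite -[RHS](margP S (subl S sSl) ltS) margE.
have nb0 : \sum_(y | fib (~~ b) y && all (x^~ y) S) d y = 0.
  by rewrite big1 // => z /andP[/d_nb + _]; rewrite negbK => /eqP.
by case: (b) nb0 => /= ->; rewrite ?addr0 ?add0r.
Qed.

Lemma sum_colmult (R : finType) m n (u : 'M[R]_(m, n)) (Q : pred 'cV[R]_m) :
  (\sum_(y | Q y) colmult u y = \sum_(i < n) Q (col i u))%N.
Proof.
rewrite exchange_big; apply: eq_bigr => i _ /=.
case: (boolP (Q (col i u))) => Qi.
  rewrite (bigD1 (col i u)) //= eqxx big1 // => y /andP[_ /negbTE].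
  by rewrite eq_sym => ->.
by rewrite big1 // => y Qy; apply/eqP; rewrite eqb0; apply: contraNneq Qi => ->.
Qed.

(** Makes a marginal on at most [k] coordinates visible in a projection to exactly [k] rows: [S] is
    enlarged to size [k] and enumerated in increasing order. *)
Lemma increasing_cover m k (S : {set 'I_m}) : (#|S| <= k <= m)%N ->
  exists2 js : 'I_k -> 'I_m, {homo js : a b / (a < b)%N} &
    forall j, j \in S -> exists a, js a = j.
Proof.
case/andP=> leSk lekm.
have [C] : exists C, C \in [set C : {set 'I_m} | C \subset ~: S & #|C| == (k - #|S|)%N].
  apply/card_gt0P; rewrite cards_draws bin_gt0 [#|~: S|]cardsCs setCK card_ord.
  exact: leq_sub2r.
rewrite inE => /andP[sCS /eqP cC].
have cB : #|S :|: C| = k.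
  rewrite cardsU cC (_ : S :&: C = set0) ?cards0 ?subn0 ?subnKC //.
  by apply/eqP; rewrite setIC setI_eq0 disjoints_subset.
pose js a : 'I_m := enum_val (cast_ord (esym cB) a).
exists js => [a b ltab|j jS].
  pose s := map val (enum (S :|: C)).
  have sorted_s : sorted ltn s.
    apply: (subseq_sorted ltn_trans _ (iota_ltn_sorted 0 m)).
    by rewrite -val_enum_ord map_subseq // {1}/enum_mem -enumT filter_subseq.
  have jsE c : js c = nth 0%N s c :> nat.
    by rewrite {1}/js (enum_val_nth (js c)) (nth_map (js c)) // -cardE cB.
  by rewrite !jsE (sorted_ltn_nth ltn_trans) // inE size_map -cardE cB.
have jB : j \in S :|: C by rewrite inE jS.
exists (cast_ord cB (enum_rank_in jB j)).
by rewrite /js cast_ordK enum_rankK_in.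
Qed.

Lemma colmult_rowsub m n r (u v : 'M['F_2]_(m, n)) :
  (n < 2 ^ r.+1)%N -> (r < m)%N ->
  (forall js : 'I_r.+1 -> 'I_m, {homo js : a b / (a < b)%N} ->
     colmult (rowsub js u) =1 colmult (rowsub js v)) ->
  colmult u =1 colmult v.
Proof.
move=> lt_n lt_r eq_js x0; apply/eqP; apply: contraTT lt_n => ne_x0.
pose d x : int := (colmult u x)%:Z - (colmult v x)%:Z.
pose xj (j : 'I_m) (y : 'cV['F_2]_m) := y j 0 == 1.
(* Both sides are doubled because the norm of [d] is bounded by the total multiplicity 2n of the two
   multisets. *)
rewrite -leqNgt -(leq_pmul2l (_ : 0 < 2)%N) // -expnS.
apply: (@leq_trans (\sum_y `|d y|)%N); last first.
  apply: (@leq_trans (\sum_y (colmult u y + colmult v y))%N).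
    by apply: leq_sum => y _; rewrite /d; lia.
  by rewrite big_split /= !sum_colmult !sum1_card card_ord mul2n addnn.
apply: (marginals_norm (x := xj) (l := enum 'I_m)).
- move=> y z _ _ eq_yz; apply/matrixP => j k; rewrite ord1.
  have := eq_yz j (mem_enum _ _); rewrite /xj.
  by case: (F2_eq0_or1 (y j 0)) (F2_eq0_or1 (z j 0)) => -> [] ->.
- move=> S _ ltS.
  have [|js js_homo js_cover] := @increasing_cover m r.+1 [set j in S].
    by rewrite cardsE (leq_trans (card_size _)) // ltnS.
  pose Q (z : 'cV['F_2]_r.+1) := [forall a, (js a \in S) ==> (z a 0 == 1)].
  have QE w i : all (xj^~ (col i w)) S = Q (col i (rowsub js w)).
    apply/allP/forallP => [all_S a|all_Q j jS].
      by apply/implyP => /all_S; rewrite /xj !mxE.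
    have [a jsa] := js_cover j ltac:(by rewrite inE).
    by have := all_Q a; rewrite jsa jS /xj !mxE jsa.
  have sumE w : (\sum_(y | all (xj^~ y) S) colmult w y =
      \sum_(z | Q z) colmult (rowsub js w) z)%N.
    by rewrite !sum_colmult; apply: eq_bigr => i _; rewrite QE.
  rewrite /d sumrB -!(big_morph Posz PoszD (erefl 0)).
  rewrite !sumE (eq_bigr (colmult (rowsub js v))) ?subrr // => z _.
  exact: eq_js.
by exists x0 => //; rewrite /d; lia.
Qed.

(** * Even-weight and odd-weight vectors *)

Section ParityClasses.
Variable m : nat.

Definition parity_class (b : 'F_2) : seq 'cV['F_2]_m :=
  [seq z : 'cV['F_2]_m <- enum {: 'cV['F_2]_m} | \sum_j z j 0 == b].

Lemma parity_class_uniq b : uniq (parity_class b).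
Proof. exact: filter_uniq (enum_uniq _). Qed.

Lemma mem_parity_class b z : (z \in parity_class b) = (\sum_j z j 0 == b).
Proof. by rewrite mem_filter mem_enum andbT. Qed.

(** Adding a basis vector is an involution that changes the parity of the weight. *)
Lemma parity_class_flip (j0 : 'I_m) :
  perm_eq (parity_class 1) (map (+%R (delta_mx j0 0)) (parity_class 0)).
Proof.
have flipK : involutive (+%R (delta_mx j0 0) : 'cV['F_2]_m -> 'cV['F_2]_m).
  move=> z; apply/matrixP => j k; rewrite !mxE addrA.
  by case: (_ && _); rewrite ?addr0 ?add0r // [1 + 1](_ : _ = 0) ?add0r //; apply: val_inj.
have flip_sum (z : 'cV['F_2]_m) : \sum_j (delta_mx j0 0 + z) j 0 = 1 + \sum_j z j 0.
  rewrite (eq_bigr (fun j => (j == j0)%:R + z j 0)) => [|j _]; last by rewrite !mxE andbT.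
  by rewrite big_split /= (bigD1 j0) //= eqxx big1 ?addr0 // => j /negbTE ->.
have flip_inj := inv_inj flipK.
apply: uniq_perm; rewrite ?(map_inj_uniq flip_inj) ?parity_class_uniq //.
move=> z; rewrite -{2}(flipK z) (mem_map flip_inj).
rewrite !mem_parity_class flip_sum.
by case: (F2_eq0_or1 (\sum_j z j 0)) => ->.
Qed.

Lemma size_parity_class b : (0 < m)%N -> size (parity_class b) = (2 ^ m.-1)%N.
Proof.
move=> m_gt0; pose j0 := Ordinal m_gt0.
have eq01 : size (parity_class 1) = size (parity_class 0).
  by rewrite (perm_size (parity_class_flip j0)) size_map.
have : (size (parity_class 0%R) + size (parity_class 1%R) = 2 ^ m)%N.
  have := count_predC (fun z : 'cV['F_2]_m => \sum_j z j 0 == 0) (enum {: 'cV['F_2]_m}).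
  rewrite -cardE card_mx muln1 card_ord => <-.
  rewrite !size_filter; congr (_ + _)%N; apply: eq_count => z /=.
  by case: (F2_eq0_or1 (\sum_j z j 0)) => ->.
have -> : (2 ^ m = (2 ^ m.-1).*2)%N by rewrite -mul2n -expnS prednK.
rewrite eq01 addnn => /double_inj eq0.
by case: (F2_eq0_or1 b) => ->; rewrite ?eq01.
Qed.

Definition parity_mx n (b : 'F_2) : 'M['F_2]_(m, n) :=
  \matrix_(j, i) (nth 0 (parity_class b) i) j 0.

(** The zero vector has even weight; its multiplicity tells the two matrices apart. *)
Lemma colmult_parity_mx n b : (0 < m)%N -> (2 ^ m.-1 <= n)%N ->
  colmult (parity_mx n b) 0 = ((b == 0%R) + (n - 2 ^ m.-1))%N.
Proof.
move=> m_gt0 le_n; rewrite colmult_seq size_parity_class // eqxx muln1.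
rewrite count_uniq_mem ?parity_class_uniq // mem_parity_class.
by rewrite big1 => [|j _]; rewrite ?mxE // eq_sym.
Qed.

(* Toggling a row outside the range of [js] exchanges the two parity classes. *)
Lemma colmult_rowsub_parity_mx n k (js : 'I_k -> 'I_m) :
  (k < m)%N -> (2 ^ m.-1 <= n)%N ->
  colmult (rowsub js (parity_mx n 0)) =1 colmult (rowsub js (parity_mx n 1)).
Proof.
move=> lt_k le_n x; have m_gt0 : (0 < m)%N by apply: leq_ltn_trans lt_k.
have [j0 j0P] : exists j0, j0 \notin codom js.
  apply/existsP; rewrite -negb_forall; apply: contraL lt_k => /forallP onto.
  rewrite -leqNgt -[X in (X <= _)%N]card_ord -[X in (_ <= X)%N]card_ord.
  by rewrite (leq_trans _ (leq_image_card js predT)) // subset_leq_card //; apply/subsetP.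
pose g (z : 'cV['F_2]_m) : 'cV['F_2]_k := rowsub js z.
have gE b : rowsub js (parity_mx n b) =
    \matrix_(j, i) (nth 0 (map g (parity_class b)) i) j 0.
  apply/matrixP => j i; rewrite !mxE.
  have [lt_i|le_i] := ltnP i (size (parity_class b)).
    by rewrite (nth_map 0) // !mxE.
  by rewrite !nth_default ?size_map // !mxE.
rewrite !gE !colmult_seq ?size_map ?size_parity_class //; congr (_ + _)%N.
move: (pred1 x); apply/seq.permP; rewrite perm_sym.
rewrite (perm_trans (perm_map g (parity_class_flip j0))) // -map_comp.
rewrite (eq_map (g := g)) // => z; apply/matrixP => a i; rewrite !mxE.
case: eqP => [ja|_]; last by rewrite add0r.
by case/negP: j0P; rewrite -ja codom_f.
Qed.

End ParityClasses.

(** * Values of beta_sep and sigma *)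

Lemma separated_colmult m n (u v : 'M['F_2]_(m, n)) :
  separated_by (@Sn_invariant 'F_2 m n) u v -> ~ colmult u =1 colmult v.
Proof. by case=> f inv_f ne_f /(evalV_colmult inv_f). Qed.

Lemma separating_homog_invariants m n r : (n < 2 ^ r.+1)%N ->
  separating (@homog_invariant_le 'F_2 m n (2 ^ r)).
Proof.
move=> lt_n; split=> [f [] // | u v /separated_colmult ne_uv].
by case: (homog_invariants_separate u v lt_n).
Qed.

Lemma colmult_separated m n (u v : 'M['F_2]_(m, n)) :
  ~ colmult u =1 colmult v -> separated_by (@Sn_invariant 'F_2 m n) u v.
Proof.
move=> ne_uv.
(* Any exponent large enough serves here, as the degree bound is dropped. *)
have lt_n : (n < 2 ^ n.+1)%N by rewrite expnS (leq_trans (ltn_expl n (ltnSn 1))) // leq_pmull.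
case: (homog_invariants_separate u v lt_n) => // -[f [inv_f _] ne_f].
by exists f.
Qed.

Lemma beta_sep_F2_lower m n r b : (0 < m)%N -> (2 ^ r <= n)%N ->
  separating (@homog_invariant_le 'F_2 m n b) -> (2 ^ r <= b)%N.
Proof.
move=> m_gt0 le_n [_ sep_b]; rewrite leqNgt; apply/negP => lt_b.
pose j0 := Ordinal m_gt0.
have [T] : exists T, T \in [set T : {set 'I_n} | #|T| == (2 ^ r)%N].
  by apply/card_gt0P; rewrite card_draws bin_gt0 card_ord.
rewrite inE => /eqP cT.
have [|f [inv_f [d le_d hom_f]] []] := sep_b (indicator_row j0 T) (indicator_row j0 set0).
  (* The zero column occurs n - 2^r times in the first point and n times in the second. *)
  apply: colmult_separated => /(_ 0); rewrite !colmult_indicator_row cT cards0 eqxx.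
  have /negbTE-> : delta_mx j0 0 != 0 :> 'cV['F_2]_m.
    by apply/cV0Pn; exists j0; rewrite mxE !eqxx.
  have := expn_gt0 2 r; lia.
apply: (evalV_indicator_row j0 cT inv_f) => a /(dhomog_mf hom_f) /= ->.
exact: leq_ltn_trans lt_b.
Qed.

Lemma separating_expansion m n r : (n < 2 ^ r.+1)%N -> (r < m)%N ->
  separating (@expansion 'F_2 r.+1 m n (@Sn_invariant 'F_2 r.+1 n)).
Proof.
move=> lt_n lt_r; split=> [_ [f [js [inv_f _ ->]]] | u v /separated_colmult ne_uv].
  exact: expand_invariant.
(* Finite functions make the quantification over [js] decidable, so a separating projection can be
   extracted. *)
pose incr (js : {ffun 'I_r.+1 -> 'I_m}) :=
  [forall a : 'I_r.+1, forall b : 'I_r.+1, (a < b)%N ==> (js a < js b)%N].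
pose same (js : {ffun 'I_r.+1 -> 'I_m}) :=
  [forall x, colmult (rowsub js u) x == colmult (rowsub js v) x].
have [/forall_inP eq_js|] := boolP [forall (js | incr js), same js].
  case: ne_uv; apply: (colmult_rowsub lt_n lt_r) => js js_homo x.
  have /eq_js/forallP/(_ x)/eqP : incr (finfun js).
    by apply/forallP => a; apply/forallP => b; apply/implyP; rewrite !ffunE => /js_homo.
  suff E w : rowsub (finfun js) w = rowsub js w :> 'M['F_2]_(_, n) by rewrite !E.
  by apply/matrixP => a i; rewrite !mxE ffunE.
rewrite negb_forall_in => /exists_inP[js /forallP js_incr /forallPn[x ne_x]].
have [|f inv_f ne_f] := @colmult_separated _ _ (rowsub js u) (rowsub js v).
  by move=> /(_ x) eq_x; rewrite eq_x eqxx in ne_x.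
exists (expand js f); last by rewrite !evalV_expand.
exists f, js; split=> // a b lt_ab.
by have /forallP/(_ b)/implyP := js_incr a; apply.
Qed.

Lemma sigma_F2_lower n r k (S : {mpoly 'F_2[k * n]} -> Prop) :
  (2 ^ r <= n)%N -> separating S ->
  (forall m, (k <= m)%N -> separating (@expansion 'F_2 k m n S)) -> (r < k)%N.
Proof.
move=> le_n [inv_S _] sep_S; rewrite ltnNge; apply/negP => le_k.
(* For r + 1 rows the parity classes have 2^r elements and fit into [n] columns, while an expanded
   invariant sees only [k <= r] rows. *)
have [_ sep_r] := sep_S r.+1 (leqW le_k).
have [|_ [f [js [Sf _ ->]]]] := sep_r (parity_mx r.+1 n 0) (parity_mx r.+1 n 1).
  apply: colmult_separated => /(_ 0); rewrite !colmult_parity_mx //=; lia.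
rewrite !evalV_expand; apply.
by apply: evalV_colmult; [exact: inv_S | exact: colmult_rowsub_parity_mx].
Qed.

Theorem corollary4p12 (n m : nat) (hn : (1 <= n)%N) (hm : (1 <= m)%N) :
  is_beta_sep 'F_2 m n (2 ^ trunc_log 2 n)%N /\
  is_sigma 'F_2 n (trunc_log 2 n + 1)%N.
Proof.
have /andP[le_n lt_n] := trunc_log_bounds (ltnSn 1) hn.
split; first by split; [exact: separating_homog_invariants | move=> b; apply: beta_sep_F2_lower].
rewrite addn1; split=> [|k [_ [S sep_S sep_expS]]]; last exact: sigma_F2_lower sep_S sep_expS.
split=> //; exists (@Sn_invariant 'F_2 _ n) => [|m' lt_m']; first by [].
exact: separating_expansion.
Qed.
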